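(* Let $\mathbf{M}=(M_0,M_1,\ldots,M_k)$, where each $M_i\in\mathbb{R}^{n\times n}$ is a strictly diagonally dominant (sdd) matrix, and suppose that for each $s=1,\ldots,n$ the $s$-th diagonal entries of $M_0,M_1,\ldots,M_k$ all have the same sign. Then $$(\alpha_\ell(\mathbf{M}))_\infty\le\delta_\ell,\qquad \ell=0,1,\ldots,k,$$ where $$(\alpha_\ell(\mathbf{M}))_\infty=\max_{(D_0,\ldots,D_k)\in\mathcal{D}}\|S_{\mathbf{M}}^{-1}D_\ell\|_\infty,\qquad \delta_\ell=\frac{1}{\min_{1\le i\le n}\{(\langle M_\ell\rangle e)_i\}}.$$
   Context: A matrix $A=(a_{ij})\in\mathbb{R}^{n\times n}$ is sdd if $|a_{ii}|>\sum_{j\ne i}|a_{ij}|$ for all $i$. The comparison matrix $\langle A\rangle$ has entries $\langle a\rangle_{ii}=|a_{ii}|$ and $\langle a\rangle_{ij}=-|a_{ij}|$ for $i\ne j$. $e=(1,\ldots,1)^T$. $\mathcal{D}$ is the set of all tuples $(D_0,\ldots,D_k)$ of $n\times n$ diagonal matrices with diagonal entries in $[0,1]$ and $\sum_{i=0}^kD_i=I$. For $(D_0,\ldots,D_k)\in\mathcal{D}$, $S_{\mathbf{M}}=\sum_{i=0}^kD_iM_i$ (nonsingular for every such tuple under the stated hypotheses). $\|\cdot\|_\infty$ is the matrix norm induced by the vector $\infty$-norm. *)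

(* Defs.v *)
From HB Require Import structures.
From mathcomp Require Import all_boot all_order all_algebra.
From mathcomp Require Import all_classical all_reals topology normedtype.

Set Implicit Arguments.
Unset Strict Implicit.
Unset Printing Implicit Defensive.

Import Order.TTheory GRing.Theory Num.Theory.
Import numFieldNormedType.Exports.

Local Open Scope classical_set_scope.
Local Open Scope ring_scope.

Definition sdd (R : realType) (n : nat) (A : 'M[R]_n) : Prop :=
  forall i : 'I_n, \sum_(j < n | j != i) `|A i j| < `|A i i|.

Definition comparison_mx (R : realType) (n : nat) (A : 'M[R]_n) : 'M[R]_n :=
  \matrix_(i, j) (if i == j then `|A i j| else - `|A i j|).

(* The norm of a column vector provided by matrix_normedtype is the largest
   absolute value of its entries, so this is the matrix norm induced by the
   vector oo-norm; on square matrices, by contrast, the library norm `|A| is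
   the entrywise maximum, which is not the induced norm. *)
Definition infty_norm (R : realType) (n : nat) (A : 'M[R]_n) : R :=
  sup [set `|A *m x| | x in [set x : 'cV[R]_n | `|x| = 1]].

Definition diag_partition (R : realType) (k n : nat)
    (D : 'I_k.+1 -> 'M[R]_n) : Prop :=
  [/\ forall i, is_diag_mx (D i),
      forall i s, 0 <= D i s s <= 1
    & \sum_(i < k.+1) D i = 1%:M].

Definition combine_mx (R : realType) (k n : nat)
    (M D : 'I_k.+1 -> 'M[R]_n) : 'M[R]_n :=
  \sum_(i < k.+1) D i *m M i.

Definition alpha_values (R : realType) (k n : nat) (M : 'I_k.+1 -> 'M[R]_n)
    (l : 'I_k.+1) : set R :=
  [set infty_norm (invmx (combine_mx M D) *m D l)
     | D in [set D : 'I_k.+1 -> 'M[R]_n | diag_partition D]].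

Definition is_max (R : realType) (E : set R) (a : R) : Prop :=
  E a /\ ubound E a.

(* [sup] is only meaningful as a maximum when [is_max (alpha_values M l)]
   holds of it. *)
Definition alpha_infty (R : realType) (k n : nat) (M : 'I_k.+1 -> 'M[R]_n)
    (l : 'I_k.+1) : R :=
  sup (alpha_values M l).

(* A minimum over the empty index set is undefined, hence the size n.+1; the
   seed of the fold is one of the entries, so it does not affect the value. *)
Definition min_entry (R : realType) (n : nat) (v : 'cV[R]_n.+1) : R :=
  \big[Num.min/v ord0 0]_(i < n.+1) v i 0.

Definition delta (R : realType) (n : nat) (A : 'M[R]_n.+1) : R :=
  1 / min_entry (comparison_mx A *m const_mx 1).

(* Main.v *)
Require Import Defs.
From mathcomp Require Import all_boot all_order all_algebra.
From mathcomp Require Import all_classical all_reals topology normedtype.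
From mathcomp Require Import derive.

Import Order.TTheory GRing.Theory Num.Theory.
Import numFieldNormedType.Exports.

(** Everything rests on a row-by-row estimate. For a row [s] of a matrix [A],
let the margin be [`|A s s| - \sum_(j != s) `|A s j|]; it is the [s]-th entry of
the comparison matrix applied to the all-ones vector. If [y] attains its norm
at coordinate [s], the triangle inequality in row [s] gives
[margin * `|y| <= `|(A *m y) s|] ([peak_row_bound]).

Because corresponding diagonal entries of the [M_i] have the same sign, they do
not cancel in [S = \sum_i D_i M_i], so the margins of [S] dominate the
corresponding convex combinations of the margins of the [M_i]
([combine_margin]). Hence [S] is again strictly diagonally dominant, and so
invertible. Moreover, if [y = S^-1 D_l x] peaks at [s], then [S y = D_l x] and
the row estimate say
[D_l s s * margin (M_l) s * `|y| <= D_l s s * `|x s|], and cancelling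
[D_l s s] bounds [`|y|] by [delta (M_l) * `|x|] ([infty_norm_combine_le]). When
[D_l s s = 0] there is nothing to cancel, but then the positive margin of [S]
forces [y = 0].

The maximum is attained by compactness. A tuple of diagonal matrices is the same
thing as a vector of its diagonal entries, the admissible vectors form a
closed subset of a cube ([partition_space_compact]), and on that set
[S^-1 D_l] depends continuously on the vector, since its entries are quotients
of polynomials with denominator [\det S != 0]. The induced norm is the largest
absolute row sum ([infty_norm_row_sum]), so it is continuous too and the extreme
value theorem applies ([alpha_values_max]). *)

Set Implicit Arguments.
Unset Strict Implicit.
Unset Printing Implicit Defensive.

Local Open Scope classical_set_scope.
Local Open Scope ring_scope.

(** * The vector and matrix norms *)

Lemma norm_entry_le (R : realType) (m n : nat) (x : 'M[R]_(m, n)) i j :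
  `|x i j| <= `|x|.
Proof.
rewrite [leRHS]/Num.norm /= mx_normrE.
exact: (le_bigmax 0 (fun ij => `|x ij.1 ij.2|) (i, j)).
Qed.

Lemma mx_norm_le (R : realType) (m n : nat) (x : 'M[R]_(m, n)) (c : R) :
  0 <= c -> (forall i j, `|x i j| <= c) -> `|x| <= c.
Proof.
move=> c0 xc; rewrite [leLHS]/Num.norm /= mx_normrE.
by apply: bigmax_le => // -[i j] _; exact: xc.
Qed.

Lemma norm_peak (R : realType) (n : nat) (x : 'cV[R]_n.+1) :
  exists s, `|x| = `|x s 0|.
Proof.
case: (@arg_maxP _ _ _ ord0 xpredT (fun s => `|x s 0|)) => // s _ smax.
exists s; apply/le_anti; rewrite norm_entry_le andbT.
by apply: mx_norm_le => // i j; rewrite ord1; exact: smax.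
Qed.

Definition max_row_sum (R : realType) (n : nat) (A : 'M[R]_n) : R :=
  \big[Num.max/0]_(i < n) \sum_j `|A i j|.

Lemma norm_mulmx_le (R : realType) (n : nat) (A : 'M[R]_n) (x : 'cV[R]_n) :
  `|A *m x| <= max_row_sum A * `|x|.
Proof.
have A0 : 0 <= max_row_sum A by exact: bigmax_ge_id.
apply: mx_norm_le => [|i j]; first by rewrite mulr_ge0.
rewrite mxE (le_trans (ler_norm_sum _ _ _))//.
have /le_trans -> // : \sum_j0 `|A i j0 * x j0 j| <= (\sum_j0 `|A i j0|) * `|x|.
  rewrite mulr_suml ler_sum// => l _.
  by rewrite normrM ler_wpM2l// norm_entry_le.
rewrite ler_wpM2r//.
exact: (le_bigmax 0 (fun i => \sum_j `|A i j|)).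
Qed.

(** The supremum defining the induced norm is hard to vary with the matrix; the
finite maximum of row sums is visibly continuous. *)
Lemma infty_norm_row_sum (R : realType) (n : nat) (A : 'M[R]_n.+1) :
  infty_norm A = max_row_sum A.
Proof.
have [i0 _ Ai0] : {i0 | i0 \in xpredT & max_row_sum A = \sum_j `|A i0 j|}.
  by apply: (eq_bigmax ord0) => // i _; exact: sumr_ge0.
(* The signs of the row with the largest sum turn that sum into an entry of
   [A *m x]. *)
pose x : 'cV[R]_n.+1 := \col_j (if A i0 j < 0 then -1 else 1).
have xe j : `|x j 0| = 1 by rewrite mxE; case: ifP; rewrite ?normrN normr1.
have x1 : `|x| = 1 by have [s ->] := norm_peak x.
have ub : ubound [set `|A *m y| | y in [set y : 'cV[R]_n.+1 | `|y| = 1]]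
    (max_row_sum A).
  move=> _ [y /= y1 <-]; have := norm_mulmx_le A y.
  by rewrite y1 mulr1.
apply/le_anti/andP; split; first by apply: ge_sup => //; exists `|A *m x|, x.
apply: (@le_trans _ _ `|A *m x|).
  rewrite Ai0; apply: le_trans (norm_entry_le (A *m x) i0 0).
  rewrite mxE (le_trans _ (ler_norm _))// ler_sum// => j _.
  rewrite mxE; case: ltrP => Aij; first by rewrite ltr0_norm// mulrN1.
  by rewrite ger0_norm// mulr1.
by apply: ub_le_sup; [exists (max_row_sum A) | exists x].
Qed.

Lemma infty_norm_le (R : realType) (n : nat) (A : 'M[R]_n.+1) (c : R) :
  (forall x : 'cV[R]_n.+1, `|A *m x| <= c * `|x|) -> infty_norm A <= c.
Proof.
move=> Ac; apply: ge_sup => [|_ [x /= x1 <-]].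
  have e1 : `|const_mx 1 : 'cV[R]_n.+1| = 1.
    by have [s ->] := norm_peak (const_mx 1 : 'cV[R]_n.+1); rewrite mxE normr1.
  by exists `|A *m (const_mx 1 : 'cV_n.+1)|, (const_mx 1).
by have := Ac x; rewrite x1 mulr1.
Qed.

(** * Row margins *)

Definition diag_margin (R : realType) (n : nat) (A : 'M[R]_n) (i : 'I_n) : R :=
  `|A i i| - \sum_(j < n | j != i) `|A i j|.

Lemma comparison_mx_ones (R : realType) (n : nat) (A : 'M[R]_n) i :
  (comparison_mx A *m const_mx 1 : 'cV_n) i 0 = diag_margin A i.
Proof.
rewrite mxE (bigD1 i)//= !mxE eqxx mulr1; congr (_ + _).
rewrite -sumrN; apply: eq_bigr => j ji.
by rewrite !mxE eq_sym (negbTE ji) mulr1.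
Qed.

Lemma sdd_margin_gt0 (R : realType) (n : nat) (A : 'M[R]_n) :
  sdd A <-> forall i, 0 < diag_margin A i.
Proof. by split=> + i => /(_ i); rewrite subr_gt0. Qed.

(** At a peak of [y], each off-diagonal term of the row has absolute value at
most [`|A s j| * `|y|], so together they leave at least the margin times
[`|y|] of the diagonal term. *)
Lemma peak_row_bound (R : realType) (n : nat) (A : 'M[R]_n) (y : 'cV[R]_n) s :
  `|y| = `|y s 0| -> diag_margin A s * `|y| <= `|(A *m y) s 0|.
Proof.
move=> ys; rewrite mxE (bigD1 s)//= mulrBl {1}ys -normrM.
apply: le_trans (lerB_normD _ _); rewrite lerD2l lerN2.
rewrite (le_trans (ler_norm_sum _ _ _))// mulr_suml ler_sum// => j _.
by rewrite normrM ler_wpM2l// norm_entry_le.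
Qed.

Lemma unitmx_ker0 (F : fieldType) (n : nat) (A : 'M[F]_n) :
  (forall y : 'cV_n, A *m y = 0 -> y = 0) -> A \in unitmx.
Proof.
move=> A0; rewrite -unitmx_tr -row_free_unit.
apply: inj_row_free => v vA; apply: trmx_inj; rewrite trmx0.
by apply: A0; rewrite -[A]trmxK -trmx_mul vA trmx0.
Qed.

(** Levy-Desplanques: a kernel vector vanishes at its own peak. *)
Lemma sdd_unitmx (R : realType) (n : nat) (A : 'M[R]_n.+1) :
  sdd A -> A \in unitmx.
Proof.
move=> /sdd_margin_gt0 A_gt0; apply: unitmx_ker0 => y Ay0.
have [s ys] := norm_peak y.
have := peak_row_bound A ys; rewrite Ay0 mxE normr0 pmulr_rle0//.
by rewrite normr_le0 => /eqP.
Qed.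

(** * Diagonal combinations of matrices *)

Lemma diag_mulmxE (R : pzSemiRingType) (m n : nat) (D : 'M[R]_m)
    (A : 'M[R]_(m, n)) s j :
  is_diag_mx D -> (D *m A) s j = D s s * A s j.
Proof.
move=> /is_diag_mxP D0; rewrite mxE (bigD1 s)//= big1 ?addr0// => i si.
by rewrite D0 ?mul0r// eq_sym.
Qed.

Section DiagCombination.
Variables (R : realType) (k n : nat) (M D : 'I_k.+1 -> 'M[R]_n.+1).
Hypothesis D_part : diag_partition D.

Lemma diag_partition_ge0 i s : 0 <= D i s s.
Proof. by case: D_part => _ /(_ i s)/andP[]. Qed.

Lemma diag_partition_sum s : \sum_i D i s s = 1.
Proof. by case: D_part => _ _ /matrixP/(_ s s); rewrite summxE mxE eqxx. Qed.

Lemma combine_mxE s j : combine_mx M D s j = \sum_i D i s s * M i s j.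
Proof.
case: D_part => diagD _ _.
by rewrite summxE; apply: eq_bigr => i _; rewrite diag_mulmxE.
Qed.

Hypothesis M_sdd : forall i, sdd (M i).
Hypothesis M_sign : forall (s : 'I_n.+1) (i j : 'I_k.+1),
  Num.sg (M i s s) = Num.sg (M j s s).

(** This is where the common signs enter: all the summands of the [s]-th
diagonal entry carry the sign of [M ord0 s s], which strict dominance makes
nonzero. *)
Lemma combine_diagonal_norm s :
  `|combine_mx M D s s| = \sum_i D i s s * `|M i s s|.
Proof.
have M0 : M ord0 s s != 0.
  by rewrite -normr_gt0; apply: le_lt_trans (M_sdd ord0 s); exact: sumr_ge0.
rewrite combine_mxE -[RHS]ger0_norm; last first.
  by apply: sumr_ge0 => i _; rewrite mulr_ge0// diag_partition_ge0.
rewrite -[RHS]mul1r -(_ : `|Num.sg (M ord0 s s)| = 1); last first.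
  by rewrite normr_sg M0.
rewrite -normrM mulr_sumr; congr `|_|; apply: eq_bigr => i _.
by rewrite {1}[M i s s]numEsg (M_sign s i ord0) mulrCA.
Qed.

(** The diagonal entries add up without cancellation, while cancellation off the
diagonal can only enlarge the margin. *)
Lemma combine_margin s :
  \sum_i D i s s * diag_margin (M i) s <= diag_margin (combine_mx M D) s.
Proof.
rewrite /diag_margin combine_diagonal_norm.
under eq_bigr do rewrite mulrBr; rewrite sumrB lerD2l lerN2.
under [leRHS]eq_bigr do rewrite mulr_sumr.
rewrite exchange_big /= ler_sum// => j _; rewrite combine_mxE.
rewrite (le_trans (ler_norm_sum _ _ _))// ler_sum// => i _.
by rewrite normrM ger0_norm// diag_partition_ge0.
Qed.

(** The weights [D i s s] sum to one, so some weight is positive and the convex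
combination of positive margins is positive. *)
Lemma combine_sdd : sdd (combine_mx M D).
Proof.
apply/sdd_margin_gt0 => s; apply: lt_le_trans (combine_margin s).
have margin_gt0 i : 0 < diag_margin (M i) s by have /sdd_margin_gt0 := M_sdd i.
have ge0 i : 0 <= D i s s * diag_margin (M i) s.
  by rewrite mulr_ge0 ?diag_partition_ge0// ltW.
rewrite lt_neqAle sumr_ge0 ?andbT// eq_sym psumr_neq0//.
have [i D_gt0|D0] := pickP (fun i => 0 < D i s s).
  by apply/hasP; exists i; rewrite ?mem_index_enum ?mulr_gt0.
have := diag_partition_sum s; rewrite big1 => [/eqP|i _].
  by rewrite eq_sym oner_eq0.
by apply/le_anti; rewrite diag_partition_ge0 leNgt D0.
Qed.

Lemma combine_unitmx : combine_mx M D \in unitmx.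
Proof. exact/sdd_unitmx/combine_sdd. Qed.

Lemma combine_margin_single l s :
  D l s s * diag_margin (M l) s <= diag_margin (combine_mx M D) s.
Proof.
apply: le_trans (combine_margin s).
rewrite [leRHS](bigD1 l)//= lerDl sumr_ge0// => i _.
rewrite mulr_ge0 ?diag_partition_ge0//.
by apply/ltW; have /sdd_margin_gt0 := M_sdd i.
Qed.

Lemma infty_norm_combine_le l :
  infty_norm (invmx (combine_mx M D) *m D l) <= delta (M l).
Proof.
set S := combine_mx M D; rewrite /delta; set mu := min_entry _.
have mu_le s : mu <= diag_margin (M l) s.
  by rewrite -comparison_mx_ones /mu /min_entry; exact: bigmin_le.
have mu_gt0 : 0 < mu.
  have /sdd_margin_gt0 Ml_gt0 := M_sdd l.
  by apply: lt_bigmin => [|i _]; rewrite comparison_mx_ones.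
apply: infty_norm_le => x; set y := _ *m x.
have Sy : S *m y = D l *m x.
  by rewrite /y -!mulmxA mulKVmx// combine_unitmx.
have [s ys] := norm_peak y.
have := peak_row_bound S ys; rewrite Sy diag_mulmxE; last by case: D_part.
rewrite normrM (ger0_norm (diag_partition_ge0 _ _)) => Sbound.
rewrite mul1r mulrC ler_pdivlMr// mulrC.
(* With a zero weight, [S *m y] vanishes in the row where [y] peaks. *)
have [D_gt0|] := ltrP 0 (D l s s); last first.
  move=> D_le0; have D0 : D l s s = 0.
    by apply/le_anti; rewrite D_le0 diag_partition_ge0.
  move: Sbound; rewrite D0 mul0r pmulr_rle0; last first.
    by have /sdd_margin_gt0 := combine_sdd.
  by rewrite normr_le0 => /eqP ->; rewrite normr0 mulr0.
rewrite -(ler_pM2l D_gt0).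
apply: le_trans (_ : D l s s * `|x s 0| <= _); last first.
  by rewrite ler_pM2l// norm_entry_le.
apply: le_trans Sbound; rewrite mulrA ler_wpM2r//.
apply: le_trans (combine_margin_single l s).
by rewrite ler_pM2l.
Qed.

End DiagCombination.

(** * Entrywise convergence of matrices *)

Section EntrywiseCvg.
Variables (R : realType) (T : Type) (F : set_system T).
Context {FF : Filter F}.

(** For a fixed size this is convergence for the norm of matrices; stated by
entries it reduces each matrix operation to sums and products of reals. *)
Definition entry_cvg (m n : nat) (A : T -> 'M[R]_(m, n)) (B : 'M[R]_(m, n)) :=
  forall i j, A t i j @[t --> F] --> B i j.

Lemma cvg_sum_fin (I : Type) (r : seq I) (P : pred I)
    (f : I -> T -> R) (a : I -> R) :
  (forall i, P i -> f i t @[t --> F] --> a i) ->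
  \sum_(i <- r | P i) f i t @[t --> F] --> \sum_(i <- r | P i) a i.
Proof. by move=> fa; apply: cvg_big => //; exact: add_continuous. Qed.

Lemma cvg_prod_fin (I : Type) (r : seq I) (P : pred I)
    (f : I -> T -> R) (a : I -> R) :
  (forall i, P i -> f i t @[t --> F] --> a i) ->
  \prod_(i <- r | P i) f i t @[t --> F] --> \prod_(i <- r | P i) a i.
Proof. by move=> fa; apply: cvg_big => //; exact: mul_continuous. Qed.

Lemma entry_cvg_mulmx (m n p : nat) (A : T -> 'M[R]_(m, n)) A'
    (B : T -> 'M[R]_(n, p)) B' :
  entry_cvg A A' -> entry_cvg B B' ->
  entry_cvg (fun t => A t *m B t) (A' *m B').
Proof.
move=> AA' BB' i j; rewrite mxE; under eq_cvg do rewrite mxE.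
by apply: cvg_sum_fin => l _; apply: cvgM; [exact: AA' | exact: BB'].
Qed.

Lemma entry_cvg_det (n : nat) (A : T -> 'M[R]_n) (B : 'M[R]_n) :
  entry_cvg A B -> \det (A t) @[t --> F] --> \det B.
Proof.
move=> AB; apply: cvg_sum_fin => s _; apply: cvgM; first exact: cvg_cst.
by apply: cvg_prod_fin => i _; exact: AB.
Qed.

Lemma entry_cvg_adj (n : nat) (A : T -> 'M[R]_n) (B : 'M[R]_n) :
  entry_cvg A B -> entry_cvg (fun t => \adj (A t)) (\adj B).
Proof.
move=> AB i j; rewrite mxE; under eq_cvg do rewrite mxE.
apply: cvgM; first exact: cvg_cst.
apply: entry_cvg_det => i' j'; rewrite !mxE; under eq_cvg do rewrite !mxE.
exact: AB.
Qed.

(** The formula [A^-1 = (\det A)^-1 *: \adj A] holds along the filter because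
[\det A] tends to a nonzero limit and is therefore eventually nonzero. *)
Lemma entry_cvg_invmx (n : nat) (A : T -> 'M[R]_n) (B : 'M[R]_n) :
  B \in unitmx -> entry_cvg A B -> entry_cvg (fun t => invmx (A t)) (invmx B).
Proof.
move=> uB AB i j; have detAB := entry_cvg_det AB.
have detB0 : \det B != 0 by rewrite -unitfE.
pose f t := (\det (A t))^-1 * \adj (A t) i j.
apply: (cvg_trans (near_eq_cvg (f := f) _)).
  apply: filterS (cvgr_neq0 _ detAB detB0) => t At0.
  by rewrite /f /invmx unitmxE unitfE At0 [RHS]mxE.
have -> : invmx B i j = (\det B)^-1 * \adj B i j by rewrite /invmx uB mxE.
apply: cvgM; last exact: entry_cvg_adj.
exact: cvgV.
Qed.

Lemma entry_cvg_max_row_sum (n : nat) (A : T -> 'M[R]_n) (B : 'M[R]_n) :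
  entry_cvg A B -> max_row_sum (A t) @[t --> F] --> max_row_sum B.
Proof.
move=> AB; apply: cvg_big => [|i _]; first exact: max_continuous.
by apply: cvg_sum_fin => j _; apply: cvg_norm; exact: AB.
Qed.

End EntrywiseCvg.

(** * Compactness of the set of diagonal partitions *)

Section PartitionSpace.
Variables (R : realType) (k n : nat).

(** Listing the diagonals of a tuple as one row vector moves the problem to the
space of row vectors, where a cube is compact by Tychonoff. *)
Definition diag_family (v : 'rV[R]_(k.+1 * n.+1)) (i : 'I_k.+1) : 'M[R]_n.+1 :=
  diag_mx (row i (vec_mx v)).

Definition partition_space : set 'rV[R]_(k.+1 * n.+1) :=
  [set v | diag_partition (diag_family v)].

Lemma diag_familyE v i s j :
  diag_family v i s j = v 0 (mxvec_index i s) *+ (s == j).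
Proof. by rewrite !mxE. Qed.

Lemma diag_family_onto (D : 'I_k.+1 -> 'M[R]_n.+1) :
  diag_partition D -> exists2 v, partition_space v & diag_family v = D.
Proof.
move=> D_part; pose v := mxvec (\matrix_(i, s) D i s s).
have vD : diag_family v = D.
  apply/funext => i; apply/matrixP => s j.
  case: D_part => /(_ i)/is_diag_mxP diagD _ _.
  rewrite diag_familyE mxvecE mxE; have [<-//|sj] := eqVneq s j.
  by rewrite mulr0n diagD.
by exists v => //; rewrite /partition_space /= vD.
Qed.

Lemma partition_space_nonempty : partition_space !=set0.
Proof.
pose D (i : 'I_k.+1) : 'M[R]_n.+1 := if i == ord0 then 1%:M else 0.
have D_part : diag_partition D.
  split=> [i|i s|].
  - rewrite /D; case: ifP => _; last exact: mx0_is_diag.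
    exact: scalar_mx_is_diag.
  - by rewrite /D; case: ifP => _; rewrite !mxE ?eqxx ?lexx ler01.
  - by rewrite (bigD1 ord0)//= big1 ?addr0// => i /negbTE i0; rewrite /D i0.
by have [v v_part _] := diag_family_onto D_part; exists v.
Qed.

(** Diagonality is built into [diag_family]; what remains is a product of
segments cut by closed linear conditions. *)
Lemma partition_spaceE : partition_space =
  [set v : 'rV[R]_(k.+1 * n.+1) | forall p, `[0, 1]%classic (v ord0 p)] `&`
  \bigcap_(s in [set: 'I_n.+1])
    ((fun v : 'rV[R]_(k.+1 * n.+1) => \sum_i v 0 (mxvec_index i s))
      @^-1` [set x | x = 1]).
Proof.
apply/seteqP; split=> v /=.
  move=> v_part; split=> [p|s _].
    case/mxvec_indexP: p => i s; rewrite /= in_itv/=.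
    by case: v_part => _ /(_ i s) + _; rewrite diag_familyE eqxx.
  rewrite /= -(diag_partition_sum v_part s).
  by apply: eq_bigr => i _; rewrite diag_familyE eqxx.
move=> [v01 v1]; split=> [i|i s|].
- exact: diag_mx_is_diag.
- by have := v01 (mxvec_index i s); rewrite /= in_itv/= diag_familyE eqxx.
- apply/matrixP => s j; rewrite summxE mxE.
  under eq_bigr do rewrite diag_familyE.
  by rewrite sumrMnl (v1 s).
Qed.

Lemma partition_space_compact : compact partition_space.
Proof.
rewrite partition_spaceE; apply: compact_closedI.
  apply: (@rV_compact R _ (fun=> `[0, 1]%classic)) => _; exact: segment_compact.
apply: closed_bigI => s _; apply: preimage_closed; last exact: closed_eq.
move=> v _; apply: (@cvg_sum_fin R _ (nbhs v)) => i _.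
exact: coord_continuous.
Qed.

Lemma combine_entry_continuous (M : 'I_k.+1 -> 'M[R]_n.+1)
    (v : 'rV[R]_(k.+1 * n.+1)) :
  entry_cvg (nbhs v) (fun w => combine_mx M (diag_family w))
    (combine_mx M (diag_family v)).
Proof.
have famE w s j : combine_mx M (diag_family w) s j =
    \sum_i w 0 (mxvec_index i s) * M i s j.
  rewrite summxE; apply: eq_bigr => i _.
  by rewrite diag_mulmxE ?diag_mx_is_diag// diag_familyE eqxx.
move=> s j; rewrite famE; under eq_cvg do rewrite famE.
apply: cvg_sum_fin => i _; apply: cvgM; last exact: cvg_cst.
exact: coord_continuous.
Qed.

Lemma diag_family_entry_continuous i (v : 'rV[R]_(k.+1 * n.+1)) :
  entry_cvg (nbhs v) (fun w => diag_family w i) (diag_family v i).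
Proof.
move=> s j; rewrite diag_familyE; under eq_cvg do rewrite diag_familyE.
by apply: cvgMn; exact: coord_continuous.
Qed.

End PartitionSpace.

(** * The maximum *)

Lemma alpha_values_max (R : realType) (k n : nat) (M : 'I_k.+1 -> 'M[R]_n.+1)
    (l : 'I_k.+1) :
  (forall D, diag_partition D -> combine_mx M D \in unitmx) ->
  exists a, is_max (alpha_values M l) a.
Proof.
move=> M_unit.
pose f (v : 'rV[R]_(k.+1 * n.+1)) :=
  infty_norm (invmx (combine_mx M (diag_family v)) *m diag_family v l).
have f_cont : {within @partition_space R k n, continuous f}.
  apply: continuous_in_subspaceT => v /set_mem /M_unit Sv.
  rewrite /f /continuous_at infty_norm_row_sum.
  under eq_cvg do rewrite infty_norm_row_sum.
  apply: (@entry_cvg_max_row_sum _ _ (nbhs v)).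
  apply: (@entry_cvg_mulmx _ _ (nbhs v)).
    apply: (@entry_cvg_invmx _ _ (nbhs v)) => //.
    exact: (@combine_entry_continuous R k n).
  exact: (@diag_family_entry_continuous R k n).
have [v /set_mem v_part vmax] :=
  compact_EVT_max (@partition_space_nonempty R k n)
    (@partition_space_compact R k n) f_cont.
exists (f v); split; first by exists (diag_family v).
move=> _ [D /= /diag_family_onto[w w_part <-] <-].
by apply: vmax; apply/mem_set.
Qed.

Lemma is_max_sup (R : realType) (E : set R) (a : R) : is_max E a -> sup E = a.
Proof.
move=> [Ea E_le]; apply/le_anti/andP; split.
  by apply: ge_sup => //; exists a.
by apply: ub_le_sup => //; exists a.
Qed.

Unset Implicit Arguments.

Theorem theorem3p5 (R : realType) (k n : nat) (M : 'I_k.+1 -> 'M[R]_n.+1)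
    (M_sdd : forall i, sdd (M i))
    (M_sign : forall (s : 'I_n.+1) (i j : 'I_k.+1),
       Num.sg (M i s s) = Num.sg (M j s s)) :
  (forall D : 'I_k.+1 -> 'M[R]_n.+1,
     diag_partition D -> combine_mx M D \in unitmx) /\
  (forall l : 'I_k.+1,
     is_max (alpha_values M l) (alpha_infty M l) /\
     alpha_infty M l <= delta (M l)).
Proof.
have M_unit D : diag_partition D -> combine_mx M D \in unitmx.
  by move=> D_part; exact: combine_unitmx.
split=> // l; have [a a_max] := alpha_values_max l M_unit.
rewrite /alpha_infty (is_max_sup a_max); split=> //.
by have [[D /= D_part <-] _] := a_max; exact: infty_norm_combine_le.
Qed.
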